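(* Let $X,Y$ be real Banach spaces, $A\subseteq X$ a nonempty closed convex set, $C\subseteq Y$ a closed convex cone with nonempty interior, and $F:X\to Y$ a continuous linear map with $F(X)\cap\operatorname{int}C\neq\emptyset$. Let $\theta$ be the associated merit function, assumed to satisfy $\theta(x)<+\infty$ for all $x\in X$. Then for every $x\in X$, $$\theta(x)=\min_{v\in K}\Bigl(\langle v,F(x)\rangle-\inf_{a\in A}\langle v,F(a)\rangle\Bigr)=\min_{v\in K}\Bigl(\langle F^*v,x\rangle+\sigma_A(-F^*v)\Bigr),$$ where $K=\overline{\operatorname{co}}^{w^*}\bigl(S(C^+)\bigr)$ and $\sigma_A(u)=\sup_{a\in A}\langle u,a\rangle$ is the support function of $A$.
   Context: $d_D(y)=\inf_{u\in D}\|y-u\|$ with $d_\emptyset\equiv+\infty$. The oriented distance function is $\Delta_D(y)=d_D(y)-d_{Y\setminus D}(y)$ with conventions $\Delta_\emptyset\equiv+\infty$, $\Delta_Y\equiv-\infty$. $C^+=\{y^*\in Y^*:\langle y^*,c\rangle\ge 0\ \forall c\in C\}$, $S(C^+)=\{y^*\in C^+:\|y^*\|=1\}$, and $\overline{\operatorname{co}}^{w^*}$ denotes the weak$^*$-closed convex hull in $Y^*$. $F^*:Y^*\to X^*$ is the adjoint of $F$. The merit function $\theta:X\to\mathbb{R}\cup\{+\infty\}$ is $$\theta(x)=\sup_{a\in A}\bigl(-\Delta_C(F(x)-F(a))\bigr)=\sup_{a\in A}\inf_{y^*\in S(C^+)}\langle y^*,F(x)-F(a)\rangle .$$ The quantities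 being minimized may take the value $+\infty$ for some $v\in K$; ''min'' means that the infimum is attained. *)

(* Defs.v *)
From HB Require Import structures.
From mathcomp Require Import all_boot all_order all_algebra.
From mathcomp Require Import all_classical all_reals ereal topology normedtype convex.

Set Implicit Arguments.
Unset Strict Implicit.
Unset Printing Implicit Defensive.

Import Order.TTheory GRing.Theory Num.Theory.
Import numFieldNormedType.Exports.

Local Open Scope classical_set_scope.
Local Open Scope ring_scope.

Definition continuous_linear (R : realType) (Y : normedModType R) :
  {pred (Y -> R^o)} := [pred f | `[< linear f /\ continuous f >]].

Lemma continuous_linear_subsemimod (R : realType) (Y : normedModType R) :
  subsemimod_closed (@continuous_linear R Y).
Proof.
split; first split.
- apply/asboolP; split => [a u v|]; first by rewrite scaler0 addr0.
  exact: cst_continuous.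
- move=> f g /asboolP[lf cf] /asboolP[lg cg]; apply/asboolP; split.
    by move=> a u v; rewrite !fctE lf lg scalerDr addrACA.
  by move=> y; apply: cvgD; [exact: cf|exact: cg].
- move=> a f /asboolP[lf cf]; apply/asboolP; split.
    by move=> b u v; rewrite !fctE lf scalerDr !scalerA mulrC.
  by move=> y; apply: cvgZr; exact: cf.
Qed.

HB.instance Definition _ (R : realType) (Y : normedModType R) :=
  GRing.isSubmodClosed.Build R (Y -> R^o) (@continuous_linear R Y)
    (@continuous_linear_subsemimod R Y).

(* The topological dual of [Y], with the pointwise operations inherited from *)
(* [Y -> R^o]. It carries no default topology: see [weak_star].              *)
Record dual (R : realType) (Y : normedModType R) := Dual {
  dual_fun :> Y -> R^o ;
  dual_funP : dual_fun \in @continuous_linear R Y }.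

HB.instance Definition _ (R : realType) (Y : normedModType R) :=
  [isSub for @dual_fun R Y].
HB.instance Definition _ (R : realType) (Y : normedModType R) :=
  [Choice of dual Y by <:].
HB.instance Definition _ (R : realType) (Y : normedModType R) :=
  [SubChoice_isSubLmodule of dual Y by <:].

(* This set is nonempty and, by continuity of [f], bounded above, so the      *)
(* real-valued supremum is the operator norm.                                *)
Definition dual_norm (R : realType) (Y : normedModType R) (f : dual Y) : R :=
  sup [set `|f y| | y in [set y : Y | `|y| <= 1]].

Definition weak_star (R : realType) (Y : normedModType R) : Type :=
  initial_topology (@dual_fun R Y : dual Y -> {ptws Y -> R}).

Definition convex_hull (R : realType) (E : lmodType R) (S : set E) : set E :=
  smallest (@convex_set R E) S.

Definition weak_star_closed_convex_hull (R : realType) (Y : normedModType R)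
    (S : set (dual Y)) : set (dual Y) :=
  closure (convex_hull S : set (weak_star Y)).

(* Asking for t = 0 as well only excludes blunt cones: it follows from t > 0  *)
(* when C is closed and nonempty.                                            *)
Definition cone (R : realType) (E : lmodType R) (C : set E) :=
  forall t c, 0 <= t -> C c -> C (t *: c).

Definition dual_cone (R : realType) (Y : normedModType R) (C : set Y) :
    set (dual Y) :=
  [set f | forall c, C c -> 0 <= f c].

Definition dual_cone_sphere (R : realType) (Y : normedModType R) (C : set Y) :
    set (dual Y) :=
  dual_cone C `&` [set f | dual_norm f = 1].

Lemma adjoint_subproof (R : realType) (X Y : normedModType R)
    (F : {linear X -> Y}) (cF : continuous F) (v : dual Y) :
  (v \o F : X -> R^o) \in @continuous_linear R X.
Proof.
have /asboolP[lv cv] := dual_funP v; apply/asboolP; split.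
  by move=> a x y; rewrite /= linearP lv.
by move=> x; apply: continuous_comp; [exact: cF|exact: cv].
Qed.

Definition adjoint (R : realType) (X Y : normedModType R)
    (F : {linear X -> Y}) (cF : continuous F) (v : dual Y) : dual X :=
  Dual (adjoint_subproof cF v).

Definition support_function (R : realType) (X : normedModType R) (A : set X)
    (u : dual X) : \bar R :=
  ereal_sup [set (u a)%:E | a in A].

Definition distance_to (R : realType) (Y : normedModType R) (D : set Y)
    (y : Y) : \bar R :=
  ereal_inf [set `|y - u|%:E | u in D].

(* Since the infimum of the empty set is +oo, the conventions that the        *)
(* oriented distance is +oo for D = set0 and -oo for D = setT are built in.   *)
Definition oriented_distance (R : realType) (Y : normedModType R) (D : set Y)
    (y : Y) : \bar R :=
  (distance_to D y - distance_to (~` D) y)%E.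

Definition merit (R : realType) (X Y : normedModType R) (A : set X) (C : set Y)
    (F : X -> Y) (x : X) : \bar R :=
  ereal_sup [set (- oriented_distance C (F x - F a)%R)%E | a in A].

(* [m] is the minimum, attained, of [f] over [K]. *)
Definition is_min (R : realType) (T : Type) (K : set T) (f : T -> \bar R)
    (m : \bar R) :=
  (f @` K) m /\ lbound (f @` K) m.

(* Main.v *)
Require Import Defs.
From HB Require Import structures.
From mathcomp Require Import all_boot all_order all_algebra.
From mathcomp Require Import all_classical all_reals ereal topology normedtype convex.
From mathcomp Require Import lra.

Set Implicit Arguments.
Unset Strict Implicit.
Unset Printing Implicit Defensive.

Import Order.TTheory GRing.Theory Num.Theory.
Import numFieldNormedType.Exports.

Local Open Scope classical_set_scope.
Local Open Scope ring_scope.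

(** Let [p y] be the supremum of [w y] for [w] in S(C^+). By separation and
    since [C] is not the whole space (otherwise theta is infinite),
    Delta_C y = p (- y), so that -theta(x) is the infimum of the sublinear
    function [p] on the convex set F(A) - F(x). The Mazur-Orlicz form of
    Hahn-Banach gives a linear [v <= p] that is at least -theta(x) on this set,
    and a second separation, in finite dimension, shows that the linear
    functionals below [p] are exactly the elements of K. So the minimum is
    attained without any appeal to weak* compactness or to a minimax theorem. *)

(** * Convex and conic combinations with real weights *)

Lemma convex_setP {R : realType} {E : lmodType R} (A : set E) :
  @convex_set R E A <->
  forall a b t, 0 <= t -> t <= 1 -> A a -> A b -> A (t *: a + (1 - t) *: b).
Proof.
split=> [cA a b t t0 t1 Aa Ab|cA a b t].
  have t01 : Itv.spec (@Itv.num_sem R) (Itv.Real `[0%Z, 1%Z]) t.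
    by rewrite /= /Itv.num_sem num_real /= in_itv /= t0 t1.
  by have /set_mem := cA a b (Itv.mk t01) (mem_set Aa) (mem_set Ab).
by rewrite !inE => Aa Ab; apply: cA.
Qed.

(** Dividing the weights by [t + s] gives a convex combination; if the sum vanishes, so do both
    weights. This merges two rays into one when subadditivity of an infimum is checked. *)
Lemma convex_set_conic {R : realType} {E : lmodType R} (A : set E) (a b : E)
    (t s : R) : @convex_set R E A -> 0 <= t -> 0 <= s -> A a -> A b ->
  exists2 c, A c & t *: a + s *: b = (t + s) *: c.
Proof.
move=> /convex_setP cA t0 s0 Aa Ab.
have [ts0|ts0] := eqVneq (t + s) 0.
  have [-> ->] : t = 0 /\ s = 0 by split; lra.
  by exists a => //; rewrite addr0 !scale0r addr0.
have ts : 0 < t + s by rewrite lt_def ts0 addr_ge0.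
exists ((t / (t + s)) *: a + (1 - t / (t + s)) *: b).
  by apply: cA => //; [rewrite divr_ge0// ltW|rewrite ler_pdivrMr// mul1r lerDl].
rewrite scalerDr !scalerA mulrBr mulr1 mulrCA mulfV// mulr1.
by rewrite [t + s]addrC addrK.
Qed.

(** * Sublinear functions, Hahn-Banach and Mazur-Orlicz theorems *)

Definition sublinear {R : realType} {E : lmodType R} (p : E -> R) :=
  (forall x y, p (x + y) <= p x + p y) /\
  (forall t x, 0 <= t -> p (t *: x) <= t * p x).

Section HahnBanach.
Context {R : realType} {E : lmodType R}.
Implicit Types (p q : E -> R) (D : set E).

Lemma linear_opp (f : E -> R^o) x : linear f -> f (- x) = - f x.
Proof.
move=> lf.
have f0 : f 0 = 0 by have := lf (-1) 0 0; rewrite scaler0 addr0 scaleN1r addNr.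
by rewrite -scaleN1r -[X in f X]addr0 lf f0 addr0 scaleN1r.
Qed.

Lemma sublinear0 p : sublinear p -> p 0 = 0.
Proof.
move=> [pD pZ]; apply/eqP; rewrite eq_le; apply/andP; split.
  by have := pZ 0 0 (lexx _); rewrite scale0r mul0r.
by have := pD 0 0; rewrite addr0 lerDl.
Qed.

Lemma sublinear_geN p x : sublinear p -> - p (- x) <= p x.
Proof.
move=> sp; have := sp.1 x (- x).
by rewrite subrr (sublinear0 sp) => h; lra.
Qed.

(* The witness is [q y = inf (p (y + t d) - t b)] over [d] in [D] and [0 <= t]. *)
Lemma sublinear_decrease p D b : sublinear p -> @convex_set R E D ->
    D !=set0 -> (forall d, D d -> b <= p d) ->
  exists q, [/\ sublinear q, forall x, q x <= p x &
                forall d, D d -> q (- d) <= - b].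
Proof.
move=> sp cD [d0 Dd0] pb; have [pD pZ] := sp.
pose B y := [set r | exists d t, [/\ D d, 0 <= t & r = p (y + t *: d) - t * b]].
(* Follows from [p (t *: d) <= p (y + t *: d) + p (- y)] and [t * b <= p (t *: d)]; it makes the
   infimum of [B y] a genuine one. *)
have lbB y : lbound (B y) (- p (- y)).
  move=> _ [d [t [Dd t0 ->]]].
  have := pD (y + t *: d) (- y); rewrite addrAC subrr add0r.
  have : t * b <= p (t *: d).
    have [->|tn0] := eqVneq t 0; first by rewrite mul0r scale0r sublinear0.
    have tgt0 : 0 < t by rewrite lt_def tn0.
    apply: (le_trans (ler_wpM2l t0 (pb _ Dd))).
    rewrite -ler_pdivlMl//.
    have := pZ t^-1 (t *: d); rewrite scalerA mulVf// scale1r; apply.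
    by rewrite invr_ge0.
  by move=> h1 h2; lra.
have B0 y : B y !=set0 by exists (p (y + 0 *: d0) - 0 * b), d0, 0.
have Binf y r : B y r -> inf (B y) <= r.
  by move=> Br; apply: ge_inf => //; exists (- p (- y)).
exists (fun y => inf (B y)); split.
- split=> [x y|t x t0].
    rewrite -lerBlDr; apply: lb_le_inf => // _ [d [t [Dd t0 ->]]].
    rewrite lerBlDr -lerBlDl; apply: lb_le_inf => // _ [e [s [De s0 ->]]].
    rewrite lerBlDl.
    (* Convexity of [D] enters here: both directions are replaced by a single one of weight
       [t + s]. *)
    have [c Dc hc] := convex_set_conic cD t0 s0 Dd De.
    apply: le_trans (Binf _ (p (x + y + (t + s) *: c) - (t + s) * b) _) _.
      by exists c, (t + s); split => //; rewrite addr_ge0.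
    rewrite -hc addrACA; have := pD (x + t *: d) (y + s *: e); lra.
  have [->|tn0] := eqVneq t 0.
    rewrite scale0r mul0r; apply: le_trans (Binf _ (p (0 + 0 *: d0) - 0 * b) _) _.
      by exists d0, 0.
    by rewrite scale0r addr0 mul0r subr0 sublinear0.
  have tgt0 : 0 < t by rewrite lt_def tn0.
  rewrite -ler_pdivrMl//; apply: lb_le_inf => // _ [d [s [Dd s0 ->]]].
  rewrite ler_pdivrMl//.
  apply: le_trans (Binf _ (p (t *: x + (t * s) *: d) - (t * s) * b) _) _.
    by exists d, (t * s); split => //; rewrite mulr_ge0.
  by rewrite -scalerA -scalerDr; have := pZ t (x + s *: d) t0; lra.
- move=> x; apply: Binf; exists d0, 0; split => //.
  by rewrite scale0r addr0 mul0r subr0.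
- move=> d Dd; apply: Binf; exists d, 1; split => //.
  by rewrite scale1r addNr mul1r (sublinear0 sp) sub0r.
Qed.

(** The pointwise infimum works: [- p (- x)] bounds it below, and of two comparable members the
    smaller one serves at both points, which gives subadditivity. *)
Lemma chain_sublinear (T : set (E -> R)) p : T !=set0 ->
    (forall q, T q -> sublinear q /\ forall x, q x <= p x) ->
    total_on T (fun q r => forall x, r x <= q x) ->
  exists2 r, sublinear r & forall q, T q -> forall x, r x <= q x.
Proof.
move=> [p0 Tp0] Tsub Ttot.
pose B x := [set q x | q in T].
have lbB x : lbound (B x) (- (p (- x))).
  move=> _ [q Tq <-]; apply: le_trans (sublinear_geN x (Tsub _ Tq).1).
  by rewrite lerN2; exact: (Tsub _ Tq).2.
have B0 x : B x !=set0 by exists (p0 x), p0.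
have Binf x q : T q -> inf (B x) <= q x.
  by move=> Tq; apply: ge_inf; [exists (- (p (- x)))|exists q].
exists (fun x => inf (B x)); last by move=> q Tq x; exact: Binf.
split=> [x y|t x t0].
  rewrite -lerBlDr; apply: lb_le_inf => // _ [q Tq <-].
  rewrite lerBlDr -lerBlDl; apply: lb_le_inf => // _ [r Tr <-].
  rewrite lerBlDl; have [rq|qr] := Ttot _ _ Tq Tr.
    apply: le_trans (Binf _ _ Tr) _; apply: le_trans ((Tsub _ Tr).1.1 _ _) _.
    by rewrite lerD2r.
  apply: le_trans (Binf _ _ Tq) _; apply: le_trans ((Tsub _ Tq).1.1 _ _) _.
  by rewrite lerD2l.
have [->|tn0] := eqVneq t 0.
  rewrite scale0r mul0r; apply: le_trans (Binf _ _ Tp0) _.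
  by rewrite (sublinear0 (Tsub _ Tp0).1).
have tgt0 : 0 < t by rewrite lt_def tn0.
rewrite -ler_pdivrMl//; apply: lb_le_inf => // _ [q Tq <-].
rewrite ler_pdivrMl//; apply: le_trans (Binf _ _ Tq) _.
exact: (Tsub _ Tq).1.2.
Qed.

(* Decreasing [p] along the singleton [x] cannot change it, so [p] is odd. *)
Lemma minimal_sublinear_linear p : sublinear p ->
    (forall q, sublinear q -> (forall x, q x <= p x) ->
      forall x, p x <= q x) ->
  linear (p : E -> R^o).
Proof.
move=> sp pmin.
have pN x : p (- x) = - p x.
  apply/eqP; rewrite eq_le; apply/andP; split; last first.
    by have := sublinear_geN (- x) sp; rewrite opprK.
  have cx : @convex_set R E [set x].
    apply/convex_setP => _ _ t t0 t1 -> ->.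
    by rewrite -scalerDl addrC subrK scale1r.
  have [||q [sq qp qx]] := @sublinear_decrease p [set x] (p x) sp cx.
  - by exists x.
  - by move=> _ ->.
  - by apply: le_trans (pmin _ sq qp _) _; apply: qx.
have pZ t x : 0 <= t -> p (t *: x) = t * p x.
  move=> t0; apply/eqP; rewrite eq_le sp.2//=.
  by have := sp.2 t (- x) t0; rewrite scalerN !pN mulrN lerN2.
have pD x y : p (x + y) = p x + p y.
  apply/eqP; rewrite eq_le sp.1/=.
  by have := sp.1 (- x) (- y); rewrite -opprD !pN -opprD lerN2.
move=> t x y; rewrite pD; congr (_ + _).
have [t0|t0] := leP 0 t; first exact: pZ.
have := pZ (- t) x; rewrite scaleNr pN mulNr => /(_ _)/oppr_inj; apply.
by rewrite oppr_ge0 ltW.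
Qed.

(** Zorn's lemma yields a minimal sublinear function below [p], and minimality forces linearity. *)
Lemma hahn_banach p : sublinear p ->
  exists2 f : E -> R^o, linear f & forall x, f x <= p x.
Proof.
move=> sp.
pose T := {q : E -> R | sublinear q /\ forall x, q x <= p x}.
pose t0 : T := exist _ p (conj sp (fun x => lexx (p x))).
(* The order is reversed, so that a maximal element is a minimal function. *)
pose rel (q r : T) : bool := `[< forall x, sval r x <= sval q x >].
have [|||[q [sq qp]] qmin] := @ZL_preorder T t0 rel.
- by move=> q; apply/asboolP.
- move=> q r s /asboolP qr /asboolP rs; apply/asboolP => x.
  exact: le_trans (rs x) (qr x).
- move=> A Atot; have [[a Aa]|A0] := pselect (A !=set0); last first.
    by exists t0 => s As; case: A0; exists s.
  have [||_ _ [c Ac <-] [d Ad <-]|r sr rA] :=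
    @chain_sublinear [set sval q | q in A] p.
  + by exists (sval a), a.
  + by move=> _ [q Aq <-]; exact: (svalP q).
  + by have [/asboolP|/asboolP] := Atot _ _ Ac Ad; [left|right].
  have rp x : r x <= p x.
    by apply: le_trans (rA _ _ x) _; [exists a|exact: (svalP a).2].
  exists (exist _ r (conj sr rp)) => s As; apply/asboolP => x /=.
  by apply: rA; exists s.
exists q => //; apply: minimal_sublinear_linear => // r sr rq x.
have rp y : r y <= p y by exact: le_trans (rq y) (qp y).
by have /asboolP := qmin (exist _ r (conj sr rp)) (introT (asboolP _) rq); apply.
Qed.

(** Hahn-Banach is applied to the decreased function [q]; since [f] is odd, [q (- d) <= - b] becomes
    a lower bound on [f d]. *)
Lemma mazur_orlicz p D b : sublinear p -> @convex_set R E D -> D !=set0 ->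
    (forall d, D d -> b <= p d) ->
  exists f : E -> R^o, [/\ linear f, forall x, f x <= p x &
                           forall d, D d -> b <= f d].
Proof.
move=> sp cD D0 pb; have [q [sq qp qD]] := sublinear_decrease sp cD D0 pb.
have [f lf fq] := hahn_banach sq; exists f; split => // [x|d Dd].
  exact: le_trans (fq x) (qp x).
by rewrite -lerN2 -linear_opp//; exact: le_trans (fq _) (qD _ Dd).
Qed.

End HahnBanach.

(** * The dual space and weak* closed convex hulls *)

Lemma dual_fun_linear {R : realType} {Y : normedModType R} (v : dual Y) :
  linear (v : Y -> R^o).
Proof. by have /asboolP[] := dual_funP v. Qed.

HB.instance Definition _ (R : realType) (Y : normedModType R) (v : dual Y) :=
  GRing.isLinear.Build R Y R^o _ (dual_fun v) (dual_fun_linear v).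

Section Dual.
Context {R : realType} {Y : normedModType R}.
Implicit Types (v w : dual Y) (S : set (dual Y)).

Lemma dualZ v t y : v (t *: y) = t * v y.
Proof. exact: linearZ. Qed.

Lemma dualB v y z : v (y - z) = v y - v z.
Proof. exact: linearB. Qed.

Lemma dual_lin2 v w a b y : (a *: v + b *: w) y = a * v y + b * w y.
Proof. by []. Qed.

Lemma dual_comb v n (a : 'I_n -> R) (ys : 'I_n -> Y) :
  v (\sum_i a i *: ys i) = \sum_i a i * v (ys i).
Proof. by rewrite linear_sum; apply: eq_bigr => i _; exact: dualZ. Qed.

Lemma dual_norm_has_sup v : has_sup [set `|v y| | y in [set y : Y | `|y| <= 1]].
Proof.
split; first by exists `|v 0|, 0 => //=; rewrite normr0.
have /asboolP[_ cv] := dual_funP v.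
have /linear_boundedP/pinfty_ex_gt0[r r0 vr] :
  bounded_near v (nbhs (0 : Y)) by apply/linear_bounded_continuous.
exists r => _ [y /= y1 <-]; apply: le_trans (vr y) _.
by rewrite ler_piMr // ltW.
Qed.

Lemma dual_norm_ge v y : `|v y| <= dual_norm v * `|y|.
Proof.
have [->|y0] := eqVneq y 0; first by rewrite linear0 !normr0 mulr0.
have ny : 0 < `|y| by rewrite normr_gt0.
rewrite -ler_pdivrMr//; apply: (ub_le_sup (dual_norm_has_sup v).2).
exists (`|y|^-1 *: y); first by rewrite /= normrZ normfV normr_id mulVf// gt_eqF.
by rewrite dualZ normrM normfV normr_id mulrC.
Qed.

Lemma dual_norm_le v r : (forall y, `|v y| <= r * `|y|) -> 0 <= r ->
  dual_norm v <= r.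
Proof.
move=> vr r0; apply: (ge_sup (dual_norm_has_sup v).1) => _ [y /= y1 <-].
by apply: le_trans (vr y) _; rewrite ler_piMr.
Qed.

Lemma dominated_abs_le (f : Y -> R^o) : linear f -> (forall y, f y <= `|y|) ->
  forall y, `|f y| <= `|y|.
Proof.
move=> lf fn y; rewrite ler_norml fn andbT lerNl -linear_opp// -normrN.
exact: fn.
Qed.

(** Turns the purely algebraic functionals produced by Mazur-Orlicz into elements of the dual. *)
Lemma dominated_dual (f : Y -> R^o) : linear f -> (forall y, f y <= `|y|) ->
  f \in @continuous_linear R Y.
Proof.
move=> lf fn; apply/asboolP; split => //.
pose g := HB.pack_for {linear Y -> R^o} f (GRing.isLinear.Build R Y R^o _ f lf).
have : bounded_near g (nbhs (0 : Y)).
  apply/linear_boundedP; near=> r => y.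
  apply: le_trans (dominated_abs_le lf fn y) _.
  by rewrite ler_peMl//; near: r; apply: nbhs_pinfty_ge; rewrite num_real.
exact: bounded_linear_continuous.
Unshelve. all: by end_near. Qed.

Lemma convex_hull_convex (E : lmodType R) (T : set E) :
  @convex_set R E (convex_hull T).
Proof.
apply/convex_setP => a b t t0 t1 Ta Tb A [cA TA].
by move/convex_setP: (cA); apply => //; [exact: Ta|exact: Tb].
Qed.

Lemma convex_hull_dual_le S w y r : (forall w, S w -> w y <= r) ->
  convex_hull S w -> w y <= r.
Proof.
move=> Sr; apply: (smallest_sub (X := [set w : dual Y | w y <= r])) => //.
apply/convex_setP => a b t t0 t1 ar br.
move: (ar) (br); rewrite /mkset => {}ar {}br.
rewrite dual_lin2; nra.
Qed.

(* Otherwise the vectors [(v - w) (ys i)], [w] in the hull, form a convex set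
   away from 0 in R^n; a functional separating it from 0 is the evaluation at a
   combination of the [ys i], at which [v] violates the hypothesis. *)
Lemma weak_star_approx S v n (ys : 'I_n -> Y) (e : R) :
    (forall y r, (forall w, S w -> w y <= r) -> v y <= r) -> 0 < e ->
  exists2 w, convex_hull S w & \sum_i `|v (ys i) - w (ys i)| < e.
Proof.
move=> vS e0; apply: contrapT => far.
have {}far w : convex_hull S w -> e <= \sum_i `|v (ys i) - w (ys i)|.
  by move=> hw; rewrite leNgt; apply/negP => we; apply: far; exists w.
pose p (r : 'rV[R]_n) := \sum_i `|r 0 i|.
have sp : sublinear p.
  split=> [x y|t x t0].
    by rewrite -big_split/=; apply: ler_sum => i _; rewrite mxE ler_normD.
  rewrite /p mulr_sumr; apply: ler_sum => i _.
  by rewrite mxE normrM ger0_norm.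
pose h w : 'rV[R]_n := \row_i (v (ys i) - w (ys i)).
(* For empty [S] the hypothesis at [y = 0], [r = -1] would read [0 <= -1]. *)
have [w0 Sw0] : S !=set0.
  apply: contrapT => S0; have := vS 0 (-1); rewrite linear0 => /(_ _).
  by rewrite leNgt ltrN10 => /(_ _)/notF; apply=> w Sw; case: S0; exists w.
have [||d [w hw <-]|L [lL Lp LD]] := @mazur_orlicz R _ p (h @` convex_hull S) e sp.
- apply/convex_setP => _ _ t t0 t1 [a ha <-] [b hb <-].
  have /convex_setP/(_ a b t t0 t1 ha hb) hab :=
    @convex_hull_convex (dual Y : lmodType R) S.
  exists (t *: a + (1 - t) *: b) => //.
  by apply/rowP => i; rewrite !mxE dual_lin2; lra.
- by exists (h w0), w0 => //; exact: sub_gen_smallest.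
- by apply: le_trans (far _ hw) _; apply: ler_sum => i _; rewrite mxE.
pose y := \sum_i L (delta_mx 0 i) *: ys i.
pose g := HB.pack_for {linear 'rV[R]_n -> R^o} L (GRing.isLinear.Build R _ R^o _ L lL).
have Ly w : L (h w) = v y - w y.
  rewrite !dual_comb -sumrB [h w]row_sum_delta.
  transitivity (\sum_i h w 0 i * L (delta_mx 0 i)).
    by rewrite -[L]/(g : _ -> _) linear_sum; apply: eq_bigr => i _; rewrite linearZ.
  by apply: eq_bigr => i _; rewrite mxE -mulrBr mulrC.
have : v y <= v y - e.
  apply: vS => w Sw; have : e <= v y - w y.
    by rewrite -Ly; apply: LD; exists w => //; exact: sub_gen_smallest.
  lra.
lra.
Qed.

Lemma weak_star_cvgP (F : set_system (dual Y)) v : Filter F ->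
  (forall y, (fun w : dual Y => w y : R) @ F --> (v y : R)) ->
  F --> (v : weak_star Y).
Proof.
move=> FF Fv A [_ [[B oB <-] Bv BA]].
have : {ptws, (@dual_fun R Y @ F) --> (dual_fun v : Y -> R)}.
  by apply/pointwise_cvgP => y; exact: Fv.
move=> /(_ B (open_nbhs_nbhs (conj oB Bv))) FB.
exact: (@filterS _ F FF (@dual_fun R Y @^-1` B)).
Qed.

Lemma weak_star_eval_continuous y :
  continuous ((fun w : dual Y => w y : R) : weak_star Y -> R).
Proof.
move=> v.
have : {ptws, @dual_fun R Y @ nbhs (v : weak_star Y) --> (dual_fun v : Y -> R)}.
  exact: (@initial_continuous (dual Y) {ptws Y -> R} (@dual_fun R Y) v).
by move/pointwise_cvgP => /(_ y).
Qed.

(** The hull is the intersection of the half-spaces, given by evaluation at points of [Y], that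
    contain [S]. These are convex and weak* closed; conversely, [weak_star_approx] finds points of
    the hull near [v] on any finite list of vectors. *)
Lemma weak_star_closed_convex_hullP S v :
  weak_star_closed_convex_hull S v <->
  forall y r, (forall w, S w -> w y <= r) -> v y <= r.
Proof.
split=> [Kv y r Sr|vS].
  have cl : closed ([set w : dual Y | w y <= r] : set (weak_star Y)).
    by have /continuous_closedP/(_ _ (@closed_le _ r)) := @weak_star_eval_continuous y.
  have : closure ([set w : dual Y | w y <= r] : set (weak_star Y)) v.
    apply: (@closureS (weak_star Y) (convex_hull S)) Kv => w.
    exact: convex_hull_dual_le.
  by rewrite -(closure_id _).1.
(* These sets generate a filter converging weak* to [v], so each neighbourhood of [v] contains one
   of them, and none is empty. *)
pose near_v (s : seq Y) (e : R) :=
  [set w | convex_hull S w /\ \sum_(y <- s) `|v y - w y| < e].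
pose F : set_system (dual Y) :=
  [set B | exists s e, 0 < e /\ near_v s e `<=` B].
have FF : Filter F.
  split; first by exists [::], 1.
    move=> A B [s [e [e0 sA]]] [t [d [d0 tB]]].
    exists (s ++ t), (Num.min e d); split; first by rewrite lt_min e0.
    move=> w [hw]; rewrite big_cat /= lt_min => /andP[we wd].
    have s0 : 0 <= \sum_(y <- s) `|v y - w y| by exact: sumr_ge0.
    have t0 : 0 <= \sum_(y <- t) `|v y - w y| by exact: sumr_ge0.
    by split; [apply: sA; split => //; lra|apply: tB; split => //; lra].
  by move=> A B AB [s [e [e0 sA]]]; exists s, e; split => // w /sA/AB.
have Fv : F --> (v : weak_star Y).
  apply: weak_star_cvgP => y; apply/cvgrPdist_lt => e e0.
  by exists [:: y], e; split => // w [_]; rewrite big_seq1.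
move=> B /Fv[s [e [e0 sB]]].
have [w hw we] := weak_star_approx (fun i : 'I_(size s) => s`_i) vS e0.
exists w; split => //; apply: sB; split => //.
by rewrite (big_nth 0) big_mkord.
Qed.

End Dual.

(** * Oriented distance and separation from a convex cone *)

Section Distance.
Context {R : realType} {Y : normedModType R}.
Implicit Types (D C : set Y) (y : Y) (v : dual Y).

(* Real-valued, hence 0 instead of +oo for [D = set0]. *)
Definition dist D y : R := inf [set `|y - u| | u in D].

Lemma distance_toE D y : D !=set0 -> distance_to D y = (dist D y)%:E.
Proof.
move=> D0; rewrite /distance_to /dist -ereal_inf_EFin.
- by rewrite image_comp.
- by exists 0 => _ [u _ <-].
- by case: D0 => u Du; exists `|y - u|, u.
Qed.

Lemma dist_le D y u : D u -> dist D y <= `|y - u|.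
Proof. by move=> Du; apply: ge_inf; [exists 0 => _ [? _ <-]|exists u]. Qed.

Lemma dist_ge D y r : D !=set0 -> (forall u, D u -> r <= `|y - u|) -> r <= dist D y.
Proof.
move=> [u Du] Dr; apply: lb_le_inf; first by exists `|y - u|, u.
by move=> _ [w Dw <-]; exact: Dr.
Qed.

Lemma dist_lt D y r : D !=set0 -> dist D y < r -> exists2 u, D u & `|y - u| < r.
Proof.
by move=> [u Du] /inf_lt[|_ [w Dw <-] wr]; [exists `|y - u|, u|exists w].
Qed.

Lemma dist_mem D y : D y -> dist D y = 0.
Proof.
move=> Dy; apply/eqP; rewrite eq_le; apply/andP; split.
  by have := dist_le y Dy; rewrite subrr normr0.
by apply: dist_ge; [exists y|].
Qed.

Lemma dist_gt0 D y : closed D -> D !=set0 -> ~ D y -> 0 < dist D y.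
Proof.
move=> Dc D0 nDy; have oD : open (~` D) by exact: closed_openC.
have /nbhs_ballP[e /= e0 eD] := open_nbhs_nbhs (conj oD nDy : open_nbhs y (~` D)).
apply: lt_le_trans e0 _; apply: dist_ge => // u Du; rewrite leNgt; apply/negP => ue.
by apply: (eD u) => //; rewrite -ball_normE.
Qed.

Lemma oriented_distanceE D y : D !=set0 -> ~` D !=set0 ->
  oriented_distance D y = (dist D y - dist (~` D) y)%:E.
Proof. by move=> D0 DC0; rewrite /oriented_distance !distance_toE. Qed.

(** Outside [C], [v] is nonnegative on [C] and 1-Lipschitz. Inside, moving from [y] by slightly more
    than [v y] along a direction where [v] nearly attains its norm makes [v] negative, hence leaves
    [C]. *)
Lemma dual_cone_sphere_le C v y : C !=set0 -> ~` C !=set0 ->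
  dual_cone_sphere C v -> - v y <= dist C y - dist (~` C) y.
Proof.
move=> C0 CC0 [Cv v1].
have [Cy|nCy] := pselect (C y); last first.
  rewrite (dist_mem (nCy : (~` C) y)) subr0; apply: dist_ge => // u Cu.
  have := dual_norm_ge v (y - u); rewrite v1 mul1r => /ler_normlP[+ _].
  by rewrite dualB; have := Cv _ Cu; lra.
rewrite (dist_mem Cy) sub0r lerN2; apply/ler_addgt0Pr => e e0.
(* The ratio is below the norm of [v], so some [z] in the unit ball exceeds it; the step
   [(v y + e) *: z] then lowers [v] by more than [v y]. *)
have vy := Cv _ Cy; have ev : v y / (v y + e) < 1.
  by rewrite ltr_pdivrMr; lra.
have [_ [z /= z1 <-] vz] : exists2 r, [set `|v z| | z in [set z : Y | `|z| <= 1]] r &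
    v y / (v y + e) < r.
  by apply: sup_gt; [exact: (dual_norm_has_sup v).1|rewrite -/(dual_norm v) v1].
wlog {vz} vz : z z1 / v y / (v y + e) < v z => [H|].
  have [vz0|vz0] := leP 0 (v z); first by apply: (H z) => //; rewrite ger0_norm in vz.
  by apply: (H (- z)); rewrite ?normrN// linearN -ltr0_norm.
have nC : ~ C (y - (v y + e) *: z).
  move=> /Cv; rewrite dualB dualZ.
  by move: vz; rewrite ltr_pdivrMr; [lra|lra].
apply: le_trans (dist_le y nC) _.
rewrite opprB addrC subrK normrZ gtr0_norm; last lra.
by rewrite ler_piMr//; lra.
Qed.

(** Mazur-Orlicz for the norm on the translate of [C] by [- y], with the distance as lower bound.
    Linearity along rays makes the functional nonnegative on [C], and attaining the distance forces
    norm one. *)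
Lemma dual_cone_sphere_separate C y : closed C -> @convex_set R Y C -> cone C ->
    C !=set0 -> ~ C y ->
  exists2 v, dual_cone_sphere C v & dist C y <= - v y.
Proof.
move=> Cc Ccv Cco C0 nCy; have d0 := dist_gt0 Cc C0 nCy.
have C00 : C 0 by case: C0 => c /(Cco 0 c (lexx _)); rewrite scale0r.
have sn : sublinear (fun z : Y => `|z|).
  by split=> [a b|t a t0]; [exact: ler_normD|rewrite normrZ ger0_norm].
have [||_ [c Cc' <-]|f [lf fn fD]] :=
    @mazur_orlicz R Y (fun z : Y => `|z|) [set c - y | c in C] (dist C y) sn.
- apply/convex_setP => _ _ t t0 t1 [a Ca <-] [b Cb <-].
  exists (t *: a + (1 - t) *: b); first by move/convex_setP: Ccv; apply.
  by rewrite !scalerBr addrACA -opprD -scalerDl [t + _]addrC subrK scale1r.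
- by exists (0 - y), 0.
- by rewrite distrC; exact: dist_le.
pose v := Dual (dominated_dual lf fn).
have vD c : C c -> dist C y <= v c - v y.
  by move=> Cc'; rewrite -dualB; apply: fD; exists c.
exists v; last by have := vD _ C00; rewrite linear0 sub0r.
split.
  move=> c Cc'; rewrite leNgt; apply/negP => vc.
  (* Chosen so that [v (t *: c) - v y] is at most -1, below the positive distance. *)
  pose t := (1 + `|v y|) / - v c.
  have t0 : 0 <= t by rewrite divr_ge0//; lra.
  have := vD _ (Cco t c t0 Cc'); rewrite dualZ.
  have -> : t * v c = - (1 + `|v y|) by rewrite /t invrN mulrN mulNr mulfVK// lt_eqF.
  by have := ler_norm (- v y); rewrite normrN; lra.
apply/eqP; rewrite eq_le; apply/andP; split.
  by apply: dual_norm_le => // z; rewrite mul1r; exact: dominated_abs_le.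
(* Taking the infimum over [c] bounds the distance by [dual_norm v] times itself; as it is positive,
   the norm is at least 1. *)
have vn c : C c -> dist C y <= dual_norm v * `|y - c|.
  move=> Cc'; apply: le_trans (vD _ Cc') _; rewrite -dualB distrC.
  exact: le_trans (ler_norm _) (dual_norm_ge v _).
have n0 : 0 < dual_norm v.
  have := vn _ C00; rewrite ltNge => h; apply/negP => n0.
  by have := normr_ge0 (y - 0); nra.
have : dist C y / dual_norm v <= dist C y.
  by apply: dist_ge => // c Cc'; rewrite ler_pdivrMr// mulrC; exact: vn.
by rewrite ler_pdivrMr// ler_pMr.
Qed.

(** For [y] in [C], a nearby point [u] outside [C] is separated instead: [v u < 0], and [v y]
    exceeds [v u] by at most the norm of [y - u]. *)
Lemma oriented_distance_approx C y r : closed C -> @convex_set R Y C -> cone C ->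
    C !=set0 -> ~` C !=set0 -> r < dist C y - dist (~` C) y ->
  exists2 v, dual_cone_sphere C v & r < - v y.
Proof.
move=> Cc Ccv Cco C0 CC0.
have [Cy|nCy] := pselect (C y); last first.
  rewrite (dist_mem (nCy : (~` C) y)) subr0 => rd.
  have [v Sv vy] := dual_cone_sphere_separate Cc Ccv Cco C0 nCy.
  by exists v => //; exact: lt_le_trans vy.
rewrite (dist_mem Cy) sub0r ltrNr => /(dist_lt CC0)[u nCu ur].
have [v Sv vu] := dual_cone_sphere_separate Cc Ccv Cco C0 nCu.
exists v => //; have := dist_gt0 Cc C0 nCu.
have := dual_norm_ge v (y - u); rewrite Sv.2 mul1r dualB => /ler_normlP[_]; lra.
Qed.

End Distance.

(** * The sublinear upper envelope and the minimum formula *)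

Lemma sup_dual_cone_sphere_sublinear {R : realType} {Y : normedModType R}
    (C : set Y) : dual_cone_sphere C !=set0 ->
  let p y := sup [set (w : dual Y) y | w in dual_cone_sphere C] in
  [/\ sublinear p, forall y, p y <= `|y| &
      forall w, dual_cone_sphere C w -> forall y, w y <= p y].
Proof.
move=> [w0 Sw0] p.
have wn w y : dual_cone_sphere C w -> w y <= `|y|.
  move=> [_ w1]; have := dual_norm_ge w y; rewrite w1 mul1r.
  exact: le_trans (ler_norm _).
have wp w y : dual_cone_sphere C w -> w y <= p y.
  by move=> Sw; apply: ub_le_sup; [exists `|y| => _ [u Su <-]; exact: wn|exists w].
have pr y r : (forall w, dual_cone_sphere C w -> w y <= r) -> p y <= r.
  by move=> wr; apply: ge_sup; [exists (w0 y), w0|move=> _ [w Sw <-]; exact: wr].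
split=> [|y|w Sw y]; [split=> [x y|t x t0]| |exact: wp].
- by apply: pr => w Sw; rewrite linearD lerD// wp.
- by apply: pr => w Sw; rewrite dualZ ler_wpM2l// wp.
- by apply: pr => w; exact: wn.
Qed.

Theorem theorem3p3 (R : realType) (X Y : completeNormedModType R)
    (A : set X) (C : set Y) (F : {linear X -> Y}) (F_cont : continuous F)
    (A_neq0 : A !=set0) (A_closed : closed A) (A_convex : @convex_set R X A)
    (C_closed : closed C) (C_convex : @convex_set R Y C) (C_cone : cone C)
    (C_solid : C° !=set0) (F_meets : range F `&` C° !=set0)
    (theta_fin : forall x, (merit A C F x < +oo)%E) :
  let K := weak_star_closed_convex_hull (dual_cone_sphere C) in
  forall x : X,
    is_min K
      (fun v => ((v (F x))%:E - ereal_inf [set (v (F a))%:E | a in A])%E)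
      (merit A C F x) /\
    is_min K
      (fun v => ((adjoint F_cont v x)%:E
                 + support_function A (- adjoint F_cont v)%R)%E)
      (merit A C F x).
Proof.
move=> K x; set phi := fun v : dual Y => _; set psi := fun v : dual Y => _.
(* Negating the infimum of [v (F a)] gives the support function at the negated adjoint, so both
   minima are one. *)
have -> : psi = phi.
  apply/funext => v; rewrite /psi /phi /support_function -ereal_supN image_comp.
  by congr (_ + ereal_sup _)%E; apply: eq_imagel.
suff : is_min K phi (merit A C F x) by [].
have C0 : C !=set0 by case: C_solid => c /interior_subset Cc; exists c.
have [a0 Aa0] := A_neq0.
(* An empty complement lies at distance [+oo], so the term of [a0] would already make the merit
   function infinite. *)
have CC0 : ~` C !=set0.
  apply: contrapT => CC0; have := theta_fin x; rewrite ltNge => /negP; apply.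
  apply: ereal_sup_ubound; exists a0 => //.
  rewrite /oriented_distance distance_toE//.
  have -> : ~` C = set0 by apply/seteqP; split => // y Cy; case: CC0; exists y.
  by rewrite /distance_to image_set0 ereal_inf0.
pose gap a := dist C (F x - F a) - dist (~` C) (F x - F a).
have meritE : merit A C F x = ereal_sup [set (- gap a)%:E | a in A].
  by congr ereal_sup; apply: eq_imagel => a _; rewrite oriented_distanceE.
have [theta thetaE] : exists theta : R, merit A C F x = theta%:E.
  exists (fine (merit A C F x)); rewrite fineK// fin_numE (lt_eqF (theta_fin x)) andbT.
  rewrite gt_eqF// meritE; apply: lt_le_trans (ltNyr (- gap a0)) _.
  by apply: ereal_sup_ubound; exists a0.
have gap_theta a : A a -> - theta <= gap a.
  move=> Aa; rewrite lerNl -lee_fin -thetaE meritE.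
  by apply: ereal_sup_ubound; exists a.
have [z nCz] := CC0.
have [w0 Sw0 _] := dual_cone_sphere_separate C_closed C_convex C_cone C0 nCz.
have S0 : dual_cone_sphere C !=set0 by exists w0.
have phi_ge v : K v -> (merit A C F x <= phi v)%E.
  move=> /weak_star_closed_convex_hullP Kv.
  rewrite meritE; apply: ge_ereal_sup => _ [a Aa <-].
  (* Each [w] in the sphere satisfies [w (F a - F x) <= gap a], and such a half-space bound passes
     to [K]. *)
  have vgap : - gap a <= v (F x) - v (F a).
    rewrite lerNl -dualB -(_ : v (- (F x - F a)) = - v (F x - F a)); last exact: linearN.
    apply: Kv => w Sw; rewrite (_ : w _ = - w (F x - F a)); last exact: linearN.
    exact: dual_cone_sphere_le.
  apply: (@le_trans _ _ (v (F x) - v (F a))%:E); first by rewrite lee_fin.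
  by rewrite EFinB /phi leeB//; apply: ereal_inf_lbound; exists a.
split; last by move=> _ [v Kv <-]; exact: phi_ge.
have [sp pn wp] := sup_dual_cone_sphere_sublinear S0.
set p := (fun y => sup _) in sp pn wp.
have [||_ [a Aa <-]|f [lf fp fD]] :=
    @mazur_orlicz R Y p [set F a - F x | a in A] (- theta) sp.
- apply/convex_setP => _ _ t t0 t1 [a Aa <-] [b Ab <-].
  exists (t *: a + (1 - t) *: b); first by move/convex_setP: A_convex; apply.
  rewrite linearD !linearZ !scalerBr addrACA -opprD -scalerDl [t + _]addrC subrK.
  by rewrite scale1r.
- by exists (F a0 - F x), a0.
(* If [p (F a - F x)] were below [gap a], some [v] in the sphere would exceed [p] at that point. *)
- apply: le_trans (gap_theta _ Aa) _; rewrite leNgt; apply/negP => pgap.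
  have [v Sv] := oriented_distance_approx C_closed C_convex C_cone C0 CC0 pgap.
  rewrite ltNge -(_ : v (F a - F x) = - v (F x - F a)) ?wp//.
  by rewrite !dualB opprB.
have [v vf] : exists v : dual Y, dual_fun v = f.
  by exists (Dual (dominated_dual lf (fun y => le_trans (fp y) (pn y)))).
(* Any half-space bound valid on the sphere bounds [p], hence [v]. *)
have Kv : K v.
  apply/weak_star_closed_convex_hullP => y r wr; rewrite vf; apply: le_trans (fp y) _.
  by apply: ge_sup; [exists (w0 y), w0|move=> _ [w Sw <-]; exact: wr].
exists v => //; apply/eqP; rewrite eq_le phi_ge// andbT thetaE /phi.
rewrite -ereal_supN image_comp.
(* Splitting off [v (F x)] leaves [- v (F a) <= theta - v (F x)] for every [a] in [A], the lower
   bound supplied by Mazur-Orlicz. *)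
have -> : theta%:E = ((v (F x))%:E + (theta - v (F x))%:E)%E.
  by rewrite -EFinD addrC subrK.
rewrite leeD2l//; apply: ge_ereal_sup => _ [a Aa <-] /=.
rewrite lee_fin.
have : - theta <= v (F a - F x) by rewrite vf; apply: fD; exists a.
by rewrite dualB; lra.
Qed.
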